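(* Let $F$ be a forest with domination number $\gamma$. Then $F$ has at most $2.4606^\gamma$ minimum dominating sets.
   Context: All graphs are finite, simple and undirected. A dominating set of a graph $G$ is a set $D\subseteq V(G)$ such that every vertex in $V(G)\setminus D$ has a neighbor in $D$. The domination number $\gamma(G)$ is the minimum cardinality of a dominating set of $G$, and a minimum dominating set is a dominating set of cardinality $\gamma(G)$. *)

(* Defs.v *)
From mathcomp Require Import all_boot all_order all_algebra.

Set Implicit Arguments.
Unset Strict Implicit.
Unset Printing Implicit Defensive.

Section Graph.
Variables (T : finType) (e : rel T).

Definition simple_graph : Prop := symmetric e /\ irreflexive e.

(* A cycle is listed as a duplicate-free cyclic sequence of vertices. The size
   bound excludes [:: x; y] with x, y adjacent, which path.v accepts as a cycle
   but which only traverses one edge back and forth. *)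
Definition acyclic_graph : Prop := forall c : seq T, ucycle e c -> size c < 3.

Definition forest : Prop := simple_graph /\ acyclic_graph.

Definition dominating (D : {set T}) : bool :=
  [forall v in ~: D, exists u in D, e v u].

(* The whole vertex set is dominating, so the minimum is attained. *)
Definition domination_number : nat :=
  #|[arg min_(D < [set: T] | dominating D) #|D|]|.

Definition min_dominating (D : {set T}) : bool :=
  dominating D && (#|D| == domination_number).

End Graph.

(* Main.v *)
Require Import Defs.
From mathcomp Require Import all_boot all_order all_algebra.
From mathcomp Require Import zify lra.

Set Implicit Arguments.
Unset Strict Implicit.
Unset Printing Implicit Defensive.

(** Root a forest at [r] and split the sets that dominate every vertex other
    than [r] into three families: A contains [r], B avoids but dominates [r],
    C does not dominate [r].  Only the least cardinality of each family and the
    number of sets attaining it matter.  If n + 1 is the least cardinality in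
    A, sets of B or C with more than n + 1 elements never extend to a minimum
    dominating set, since a set of A can replace them; and no set of B or C has
    fewer than n elements, since adding [r] gives a set of A.  This leaves
    three kinds of rooted forest.  Joining two rooted forests by an edge
    between the roots acts bilinearly on the three counts.  Normalising a count
    of sets of size k by (27/11)^k, the count vectors of each kind stay below
    finitely many explicit triples over 27; that this table is stable under the
    join is a finite computation.  Every entry gives at most (27/11)^gamma
    minimum dominating sets, and 27/11 < 2.4606. *)

(** * Least sizes, scaled counts and products of families of sets *)

Section SizedFamilies.
Variable T : finType.
Implicit Types (F G : {set {set T}}) (D S : {set T}).

(* [F] has no member of size less than [n], and at most (p / s) (27 / 11)^n of
   size [n]. *)
Definition bounded (s : nat) F (n p : nat) : Prop :=
  (forall D, D \in F -> n <= #|D|) /\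
  s * #|[set D in F | #|D| == n]| * 11 ^ n <= p * 27 ^ n.

Definition attained F (n : nat) : Prop := exists2 D, D \in F & #|D| = n.

(** No member has a size below the least one, so the count there is 0; this is how terms of too high
    order drop out. *)
Lemma bounded_below s F n m p : bounded s F n p -> m < n -> bounded s F m 0.
Proof.
move=> [Fn _] lt_mn; split=> [D /Fn|]; first exact: leq_trans (ltnW lt_mn).
rewrite [[set _ in _ | _]](_ : _ = set0) ?cards0 ?muln0 //.
apply/setP => D; rewrite !inE; apply/negP => /andP[/Fn le_nD /eqP eD].
by rewrite eD leqNgt lt_mn in le_nD.
Qed.

Lemma bounded_set1 s D p :
  s * 11 ^ #|D| <= p * 27 ^ #|D| -> bounded s [set D] #|D| p.
Proof.
move=> le_p; split=> [E /set1P->//|]; apply: leq_trans le_p.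
rewrite leq_mul2r -{2}[s]muln1 leq_mul2l; apply/orP; right; apply/orP; right.
rewrite -(cards1 D); apply/subset_leq_card/subsetP => E.
by rewrite inE => /andP[].
Qed.

Lemma bounded_set0 s n p : bounded s set0 n p.
Proof.
split=> [D|]; first by rewrite inE.
by rewrite [[set _ in _ | _]](_ : _ = set0) ?cards0 ?muln0 //;
   apply/setP => D; rewrite !inE.
Qed.

Lemma bounded_rescale s u F n p q :
  0 < u -> p <= u * q -> bounded (u * s) F n p -> bounded s F n q.
Proof.
move=> u_gt0 le_pq [Fn cF]; split=> //.
rewrite -(leq_pmul2l u_gt0) !mulnA; apply: leq_trans cF _.
by rewrite leq_mul2r le_pq orbT.
Qed.

Lemma boundedU s F G n p q :
  bounded s F n p -> bounded s G n q -> bounded s (F :|: G) n (p + q).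
Proof.
move=> [Fn cF] [Gn cG]; split=> [D|]; first by rewrite inE => /orP[/Fn|/Gn].
apply: leq_trans (_ : _ <= s * (#|[set D in F | #|D| == n]| +
                               #|[set D in G | #|D| == n]|) * 11 ^ n) _.
  rewrite leq_mul2r leq_mul2l; apply/orP; right; apply/orP; right.
  apply: leq_trans (leq_card_setU _ _).
  by apply/subset_leq_card/subsetP => D; rewrite !inE andb_orl.
by rewrite mulnDr !mulnDl leq_add.
Qed.

Lemma attainedUl F G n : attained F n -> attained (F :|: G) n.
Proof. by case=> D FD eD; exists D; rewrite // inE FD. Qed.

Lemma attainedUr F G n : attained G n -> attained (F :|: G) n.
Proof. by rewrite setUC; apply: attainedUl. Qed.

(** The product of two families on disjoint supports, described through traces so that membership of
    [D] is a boolean test. *)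
Definition glue S0 S1 F G : {set {set T}} :=
  [set D : {set T} |
    [&& D \subset S0 :|: S1, D :&: S0 \in F & D :&: S1 \in G]].

Lemma in_glue S0 S1 F G D :
  (D \in glue S0 S1 F G) =
  [&& D \subset S0 :|: S1, D :&: S0 \in F & D :&: S1 \in G].
Proof. by rewrite in_set. Qed.

Section Glue.
Variables S0 S1 : {set T}.
Hypothesis dis : [disjoint S0 & S1].

Lemma card_glue D :
  D \subset S0 :|: S1 -> #|D| = #|D :&: S0| + #|D :&: S1|.
Proof.
move=> /setIidPl sD; rewrite -{1}sD setIUr cardsU.
by rewrite setIACA (disjoint_setI0 dis) setI0 cards0 subn0.
Qed.

(** A set is determined by its two traces, so counts multiply. The traces have at least [n] and [m]
    elements, so a total of [n + m] forces both equalities. *)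
Lemma bounded_glue s u F G n m p q :
  bounded s F n p -> bounded u G m q ->
  bounded (s * u) (glue S0 S1 F G) (n + m) (p * q).
Proof.
move=> [Fn cF] [Gm cG]; split=> [D|].
  by rewrite inE => /and3P[/card_glue-> /Fn leF /Gm leG]; apply: leq_add.
set X := [set D in F | #|D| == n] in cF.
set Y := [set D in G | #|D| == m] in cG.
suff le_c : #|[set D in glue S0 S1 F G | #|D| == n + m]| <= #|X| * #|Y|.
  apply: leq_trans (_ : (s * #|X| * 11 ^ n) * (u * #|Y| * 11 ^ m) <= _).
    rewrite expnD [leqRHS]mulnACA [s * #|X| * _]mulnACA leq_mul2r leq_mul2l.
    by rewrite le_c !orbT.
  by rewrite expnD [p * q * _]mulnACA leq_mul.
rewrite -cardsX; pose f D := (D :&: S0, D :&: S1).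
have inj_f : {in [set D in glue S0 S1 F G | #|D| == n + m] &, injective f}.
  move=> D1 D2; rewrite !inE => /andP[/and3P[/setIidPl s1 _ _] _].
  move=> /andP[/and3P[/setIidPl s2 _ _] _] [e0 e1].
  by rewrite -s1 -s2 !setIUr e0 e1.
rewrite -(card_in_imset inj_f); apply/subset_leq_card/subsetP => ? /imsetP[D].
rewrite !inE => /andP[/and3P[/card_glue-> FD GD] /eqP eD] -> /=.
have := Fn _ FD; have := Gm _ GD; rewrite FD GD /=; lia.
Qed.

Lemma bounded_glue_eq s u F G n m k p q :
  bounded s F n p -> bounded u G m q -> k = n + m ->
  bounded (s * u) (glue S0 S1 F G) k (p * q).
Proof. by move=> hF hG ->; apply: bounded_glue. Qed.

Lemma bounded_glue_lt s u F G n m k p q :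
  bounded s F n p -> bounded u G m q -> k < n + m ->
  bounded (s * u) (glue S0 S1 F G) k 0.
Proof. by move=> hF hG; apply: bounded_below (bounded_glue hF hG). Qed.

Lemma attained_glue F G n m :
    (forall D, D \in F -> D \subset S0) ->
    (forall D, D \in G -> D \subset S1) ->
  attained F n -> attained G m -> attained (glue S0 S1 F G) (n + m).
Proof.
move=> F0 G1 [D0 FD <-] [D1 GD <-]; have [s0 s1] := (F0 _ FD, G1 _ GD).
have e0 : (D0 :|: D1) :&: S0 = D0.
  rewrite setIUl (setIidPl s0) (disjoint_setI0 _) ?setU0 //.
  by rewrite disjoint_sym (disjointWr s1).
have e1 : (D0 :|: D1) :&: S1 = D1.
  rewrite setIUl (setIidPl s1) (disjoint_setI0 _) ?set0U //.
  by rewrite (disjointWl s0).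
exists (D0 :|: D1); first by rewrite inE setUSS // e0 e1 FD GD.
by rewrite card_glue ?setUSS // e0 e1.
Qed.

End Glue.
End SizedFamilies.

(** * Kinds of rooted families, the table and its stability under joining *)

Section Recursion.

(* With n + 1 the least size in A: in kind KA the families B and C start at
   n + 1, in kind KC only C starts at n, in kind KB both B and C may start at n
   and B does. *)
Inductive kind := KA | KB | KC.

Definition lvlB t := if t is KB then 0 else 1.
Definition lvlC t := if t is KA then 1 else 0.

Definition join_kind t u :=
  match u, t with KA, KA => KA | KA, _ => KB | KB, _ => t | KC, _ => KA end.

(* The lowest-order terms of A = A0 (A1 + B1 + C1), B = B0 (A1 + B1) + C0 A1 and
   C = C0 B1; a product that starts above the relevant size contributes 0. *)
Definition join_triple t u (p q : nat * nat * nat) : nat * nat * nat :=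
  let: (a, b, c) := p in let: (x, y, z) := q in
  match u with
  | KA => let b' := if t is KC then 0 else b in
          (a * (x + y + z), b' * (x + y) + c * x, c * y)
  | KB => (a * (y + z), b * y + (if t is KC then c * x else 0), c * y)
  | KC => let c' := if t is KA then 0 else c in
          let b' := if t is KB then b else 0 in
          (a * z, b' * (x + y) + c' * x, c' * y)
  end.

(* Entries are numerators over 27: the orbit of the one-vertex tree (11, 0, 27)
   under [join_triple], rounded up and reduced to its maximal elements. *)
Definition table t : seq (nat * nat * nat) :=
  match t with
  | KA => [:: (11, 11, 0); (5, 9, 9); (5, 11, 4); (6, 8, 8); (3, 6, 10)]
  | KB => [:: (9, 11, 11); (8, 14, 5); (10, 5, 9)]
  | KC => [:: (11, 0, 27); (9, 9, 11); (8, 8, 14); (6, 10, 5)]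
  end.

(** Products of two entries are numerators over 27 * 27, hence the factor 27 against a table
    entry. *)
Definition triple_le (p q : nat * nat * nat) :=
  let: (a, b, c) := p in let: (x, y, z) := q in
  [&& a <= 27 * x, b <= 27 * y & c <= 27 * z].

Lemma table_join t u p q : p \in table t -> q \in table u ->
  exists2 w, w \in table (join_kind t u) & triple_le (join_triple t u p q) w.
Proof.
have : all (fun p => all (fun q => has (triple_le (join_triple t u p q))
             (table (join_kind t u))) (table u)) (table t) by case: t; case: u.
by move=> /allP/[apply]/allP/[apply]/hasP[w]; exists w.
Qed.

(** The numerator of A and B together at their least size; in kind [KB], B starts one below A, so
    only B counts. *)
Lemma table_total t p : p \in table t ->
  (if t is KB then p.1.2 else p.1.1 + p.1.2) <= 27.
Proof.
have : all (fun p => (if t is KB then p.1.2 else p.1.1 + p.1.2) <= 27)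
    (table t) by case: t.
by move=> /allP/[apply].
Qed.

Variable T : finType.
Implicit Types (A B C F : {set {set T}}) (S : {set T}).

Definition profile s A B C t (p : nat * nat * nat) n : Prop :=
  [/\ bounded s A n.+1 p.1.1, bounded s B (n + lvlB t) p.1.2,
      bounded s C (n + lvlC t) p.2, attained A n.+1
    & match t with
      | KA => True | KB => attained B n | KC => attained C n end].

Lemma profile_join S0 S1 A0 B0 C0 A1 B1 C1 t u p q n m :
    [disjoint S0 & S1] ->
    (forall D, D \in A0 :|: B0 :|: C0 -> D \subset S0) ->
    (forall D, D \in A1 :|: B1 :|: C1 -> D \subset S1) ->
  profile 27 A0 B0 C0 t p n -> profile 27 A1 B1 C1 u q m ->
  exists k, profile (27 * 27) (glue S0 S1 A0 (A1 :|: B1 :|: C1))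
    (glue S0 S1 B0 (A1 :|: B1) :|: glue S0 S1 C0 A1)
    (glue S0 S1 C0 B1) (join_kind t u) (join_triple t u p q) k.
Proof.
move=> dis sub0 sub1.
case: p => [[a b] c]; case: q => [[x y] z].
move=> [/= hA0 hB0 hC0 aA0 at0] [/= hA1 hB1 hC1 aA1 at1].
have [sA0 sB0 sC0] : [/\ forall D, D \in A0 -> D \subset S0,
    forall D, D \in B0 -> D \subset S0 & forall D, D \in C0 -> D \subset S0].
  by split=> D FD; apply: sub0; rewrite !inE FD ?orbT.
have [sA1 sB1] : (forall D, D \in A1 -> D \subset S1) /\
    (forall D, D \in B1 -> D \subset S1).
  by split=> D FD; apply: sub1; rewrite !inE FD ?orbT.
have sAB1 D : D \in A1 :|: B1 -> D \subset S1.
  by move=> FD; apply: sub1; rewrite inE FD.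
have aABC : attained (A1 :|: B1 :|: C1) (m + lvlC u).
  case: u at1 {hB1 hC1} => /= at1.
  - by rewrite addn1; do 2!apply: attainedUl.
  - by rewrite addn0; apply: attainedUl; apply: attainedUr.
  - by rewrite addn0; apply: attainedUr.
(* A summand that starts above the level [m + lvlC u] counts as 0. *)
have hABC : bounded 27 (A1 :|: B1 :|: C1) (m + lvlC u)
    match u with KA => x + y + z | KB => 0 + y + z | KC => 0 + 0 + z end.
  have hA1' := bounded_below hA1 (ltnSn m).
  case: u at1 hB1 hC1 {aABC}; rewrite /= ?addn0 ?addn1 => _ hB1 hC1;
    do 2?apply: boundedU => //.
  exact: boundedU hA1' (bounded_below hB1 (ltnSn m)).
have hAB : bounded 27 (A1 :|: B1) (m + lvlB u)
    (if u is KB then 0 + y else x + y).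
  have hA1' := bounded_below hA1 (ltnSn m).
  by case: u at1 hB1 hC1 {aABC hABC}; rewrite /= ?addn0 ?addn1 => _ hB1 hC1;
    apply: boundedU.
(* The new A pairs [A0], of least size [n.+1], with the union of [A1], [B1], [C1], of least size
   [m + lvlC u]. *)
exists (n + m + lvlC u); split.
- case: u at1 aABC hABC {hB1 hC1 hAB} => at1 aABC hABC;
    case: t at0 {hB0 hC0} => at0 /=;
    by apply: (bounded_glue_eq dis hA0 hABC); rewrite -addnA addSn.
- case: u at1 hB1 {hC1 hABC aABC} hAB => at1 hB1 hAB;
  case: t at0 hB0 hC0 => at0 hB0 hC0 /=;
  apply: boundedU;
  (* A product starting at the required size keeps its numerator; one starting above it gets 0. *)
  first [ by apply: (bounded_glue_eq dis hB0 hAB); rewrite /=; lia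
        | by apply: (bounded_glue_lt dis hB0 hAB); rewrite /=; lia
        | by apply: (bounded_glue_eq dis hC0 hA1); rewrite /=; lia
        | by apply: (bounded_glue_lt dis hC0 hA1); rewrite /=; lia ].
- case: u at1 hB1 {hC1 hABC aABC} hAB => at1 hB1 hAB;
  case: t at0 hB0 hC0 => at0 hB0 hC0 /=;
  first [ by apply: (bounded_glue_eq dis hC0 hB1); rewrite /=; lia
        | by apply: (bounded_glue_lt dis hC0 hB1); rewrite /=; lia ].
- by rewrite -addnA -addSn; apply: attained_glue.
- case: u at1 {hB1 hC1 hABC aABC hAB} => at1;
  case: t at0 {hB0 hC0} => at0 //=; rewrite -addnA.
  (* The remaining pairs [t], [u] are, in order: [KB], [KA]; [KC], [KA]; [KB], [KB]; [KC], [KB]. *)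
  + by apply: attainedUl; apply: attained_glue => //; apply: attainedUl;
      rewrite addn1.
  + by apply: attainedUr; apply: attained_glue => //; rewrite addn1.
  + by apply: attainedUl; apply: attained_glue => //; apply: attainedUr;
      rewrite addn0.
  + by apply: attained_glue => //; rewrite addn0.
Qed.

Definition controlled A B C : Prop :=
  exists t p, p \in table t /\ exists n, profile 27 A B C t p n.

Lemma controlled_join S0 S1 A0 B0 C0 A1 B1 C1 :
    [disjoint S0 & S1] ->
    (forall D, D \in A0 :|: B0 :|: C0 -> D \subset S0) ->
    (forall D, D \in A1 :|: B1 :|: C1 -> D \subset S1) ->
  controlled A0 B0 C0 -> controlled A1 B1 C1 ->
  controlled (glue S0 S1 A0 (A1 :|: B1 :|: C1))
    (glue S0 S1 B0 (A1 :|: B1) :|: glue S0 S1 C0 A1)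
    (glue S0 S1 C0 B1).
Proof.
move=> dis sub0 sub1 [t [p [tp [n prf0]]]] [u [q [uq [m prf1]]]].
have [k [hA hB hC aA atk]] := profile_join dis sub0 sub1 prf0 prf1.
have [[[x y] z] tw] := table_join tp uq.
move: hA hB hC; case: join_triple => [[a b] c] hA hB hC /and3P[leA leB leC].
exists (join_kind t u), (x, y, z); split=> //; exists k.
by split=> //=; [move: hA|move: hB|move: hC]; apply: bounded_rescale.
Qed.

Lemma controlled_total A B C : controlled A B C ->
  exists g, bounded 27 (A :|: B) g 27 /\ attained (A :|: B) g.
Proof.
case=> t [[[a b] c] [tp [n [/= hA hB hC aA at_t]]]].
have le27 := table_total tp.
exists (n + lvlB t); split.
  apply: (@bounded_rescale _ 27 1 _ _ (if t is KB then 0 + b else a + b)) => //.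
  case: t hB {le27 tp at_t hC}; rewrite /= ?addn0 ?addn1 => hB;
    apply: boundedU => //; exact: bounded_below hA _.
case: t at_t {hB hC tp le27}; rewrite /= ?addn0 ?addn1 => at_t.
- exact: attainedUl.
- exact: attainedUr.
- exact: attainedUl.
Qed.

(** The numerator 27 over 27 of [F] is a factor 1, so the level shifts by [g] while kind and triple
    stay the same. *)
Lemma controlled_glue S0 S1 A B C F g :
    [disjoint S0 & S1] ->
    (forall D, D \in A :|: B :|: C -> D \subset S0) ->
    (forall D, D \in F -> D \subset S1) ->
  controlled A B C -> bounded 27 F g 27 -> attained F g ->
  controlled (glue S0 S1 A F) (glue S0 S1 B F) (glue S0 S1 C F).
Proof.
move=> dis sub0 sub1 [t [p [tp [n [hA hB hC aA at_t]]]]] hF aF.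
have [sA sB sC] : [/\ forall D, D \in A -> D \subset S0,
    forall D, D \in B -> D \subset S0 & forall D, D \in C -> D \subset S0].
  by split=> D FD; apply: sub0; rewrite !inE FD ?orbT.
exists t, p; split=> //; exists (n + g); split.
- apply: (@bounded_rescale _ 27 27 _ _ (p.1.1 * 27)); [by []|by rewrite mulnC|].
  by apply: (bounded_glue_eq dis hA hF).
- apply: (@bounded_rescale _ 27 27 _ _ (p.1.2 * 27)); [by []|by rewrite mulnC|].
  by apply: (bounded_glue_eq dis hB hF); rewrite addnAC.
- apply: (@bounded_rescale _ 27 27 _ _ (p.2 * 27)); [by []|by rewrite mulnC|].
  by apply: (bounded_glue_eq dis hC hF); rewrite addnAC.
- by rewrite -addSn; apply: attained_glue.
- by case: t at_t {hB hC tp} => // at_t; apply: attained_glue.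
Qed.

End Recursion.

(** * The families A, B, C of a rooted vertex set in a graph *)

Section Forest.
Variables (T : finType) (e : rel T).
Implicit Types (S D : {set T}) (r s v : T).

Definition dominated D v := (v \in D) || [exists u in D, e v u].

Definition predominating S r : {set {set T}} :=
  [set D : {set T} |
    (D \subset S) && [forall v in S :\ r, dominated D v]].

Definition famA S r := [set D in predominating S r | r \in D].
Definition famB S r :=
  [set D in predominating S r | (r \notin D) && dominated D r].
Definition famC S r := [set D in predominating S r | ~~ dominated D r].

Lemma fam_subset S r D :
  D \in famA S r :|: famB S r :|: famC S r -> D \subset S.
Proof. by rewrite !inE -!andb_orr -!andbA => /andP[]. Qed.

Lemma predominating_subset S v D : D \in predominating S v -> D \subset S.
Proof. by rewrite inE => /andP[]. Qed.

Lemma in_fam S v D :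
  ((D \in famA S v) = (D \in predominating S v) && (v \in D)) *
  ((D \in famB S v) =
     (D \in predominating S v) && ((v \notin D) && dominated D v)) *
  ((D \in famC S v) = (D \in predominating S v) && ~~ dominated D v).
Proof. by rewrite !in_set. Qed.

Lemma famAB S r : r \in S ->
  famA S r :|: famB S r =
  [set D : {set T} | (D \subset S) && [forall v in S, dominated D v]].
Proof.
move=> Sr; apply/setP => D; rewrite !inE -andb_orr -andbA; congr (_ && _).
have -> : (r \in D) || (r \notin D) && dominated D r = dominated D r.
  by rewrite /dominated; case: (r \in D).
apply/andP/forall_inP => [[/forall_inP h dr] v Sv | h].
  by have [->|nvr] := eqVneq v r; last by apply: h; rewrite !inE nvr.
by split; [apply/forall_inP => v /setD1P[_ /h] | exact: h].
Qed.

Lemma controlled_singleton r : irreflexive e ->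
  controlled (famA [set r] r) (famB [set r] r) (famC [set r] r).
Proof.
move=> irr.
have inP D : (D \in predominating [set r] r) = (D \subset [set r]).
  rewrite inE; case: (D \subset _) => //=; apply/forall_inP => v.
  by rewrite setDv inE.
have hB : famB [set r] r = set0.
  apply/setP => D; rewrite in_set0 in_set inP subset1.
  apply/negP => /andP[/orP[] /eqP-> /andP[]]; first by rewrite set11.
  move=> _ /orP[]; rewrite ?inE //.
  by case/existsP => u; rewrite inE.
have hA : famA [set r] r = [set [set r]].
  apply/setP => D; rewrite in_set inP subset1 in_set1.
  by have [->|] := eqVneq D [set r]; rewrite ?set11 //= => _;
    apply/negP => /andP[/eqP->]; rewrite inE.
have hC : famC [set r] r = [set set0].
  apply/setP => D; rewrite in_set inP subset1 in_set1.
  have [->|nD] /= := eqVneq D set0.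
    rewrite orbT /dominated inE /=; apply/existsP => -[u].
    by rewrite inE.
  by rewrite orbF; apply/negP => /andP[/eqP->]; rewrite /dominated set11.
(* A has one set of size 1, and 11/27 * 27/11 = 1; C has one set of size 0, and 27/27 = 1. *)
exists KC, (11, 0, 27); split=> //; exists 0; rewrite hA hB hC; split=> /=.
- by rewrite -(cards1 r); apply: bounded_set1; rewrite cards1.
- exact: bounded_set0.
- by rewrite -[0 + 0](cards0 T); apply: bounded_set1; rewrite cards0.
- by exists [set r]; rewrite ?set11 ?cards1.
- by exists set0; rewrite ?set11 ?cards0.
Qed.

Lemma dominatedI S D v : v \in S ->
  dominated D v = dominated (D :&: S) v || [exists u in D :\: S, e v u].
Proof.
move=> Sv; rewrite /dominated inE Sv andbT -orbA; congr (_ || _).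
apply/existsP/orP => [[u /andP[Du evu]]|].
  have [Su|nSu] := boolP (u \in S).
    by left; apply/existsP; exists u; rewrite inE Du Su.
  by right; apply/existsP; exists u; rewrite inE Du nSu.
by case=> /existsP[u /andP[]]; [move=> /setIP[Du _]|move=> /setDP[Du _]];
  move=> evu; exists u; rewrite Du.
Qed.

Hypothesis sym : symmetric e.

(** * Two vertex sets with at most the edge from [r] to [s] between them *)

Section Cut.
Variables (S0 S1 : {set T}) (r s : T).
Hypotheses (dis : [disjoint S0 & S1]) (S0r : r \in S0) (S1s : s \in S1).
Hypothesis cut :
  forall x y, x \in S0 -> y \in S1 -> e x y -> x = r /\ y = s.

Lemma dominated_cut0 D v : D \subset S0 :|: S1 -> v \in S0 ->
  dominated D v = dominated (D :&: S0) v || [&& v == r, s \in D & e r s].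
Proof.
move=> sD S0v; rewrite (dominatedI _ S0v); congr (_ || _).
apply/existsP/and3P => [[u /andP[/setDP[Du nS0u] evu]]|[/eqP-> Ds ers]].
  have S1u : u \in S1 by have := subsetP sD u Du; rewrite inE (negPf nS0u).
  by have [<- <-] := cut S0v S1u evu.
by exists s; rewrite ers andbT inE Ds andbT (disjointFl dis S1s).
Qed.

Lemma dominated_cut1 D v : D \subset S0 :|: S1 -> v \in S1 ->
  dominated D v = dominated (D :&: S1) v || [&& v == s, r \in D & e r s].
Proof.
move=> sD S1v; rewrite (dominatedI _ S1v); congr (_ || _).
apply/existsP/and3P => [[u /andP[/setDP[Du nS1u] evu]]|[/eqP-> Dr ers]].
  have S0u : u \in S0.
    by have := subsetP sD u Du; rewrite inE (negPf nS1u) orbF.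
  by rewrite sym in evu; have [<- <-] := cut S0u S1v evu.
by exists r; rewrite sym ers andbT inE Dr andbT (disjointFr dis S0r).
Qed.

(** In the whole only [r] is exempt from domination, so [s] must be dominated from its own side or
    by [r] across the edge. *)
Lemma predominating_cut D : D \subset S0 :|: S1 ->
  (D \in predominating (S0 :|: S1) r) =
  [&& D :&: S0 \in predominating S0 r, D :&: S1 \in predominating S1 s
    & dominated (D :&: S1) s || (r \in D) && e r s].
Proof.
move=> sD; rewrite !inE sD !subsetIr /=.
apply/forall_inP/and3P => [h|[/forall_inP h0 /forall_inP h1 hs] v].
  have h1 v : v \in S1 ->
      dominated (D :&: S1) v || [&& v == s, r \in D & e r s].
    move=> S1v; rewrite -dominated_cut1 //; apply: h; rewrite !inE S1v orbT.
    by rewrite andbT; apply: contraTneq S1v => ->; rewrite (disjointFr dis S0r).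
  split.
  - apply/forall_inP => v /setD1P[nvr S0v].
    have := h v; rewrite !inE nvr S0v dominated_cut0 // (negPf nvr) orbF.
    exact.
  - by apply/forall_inP => v /setD1P[nvs /h1]; rewrite (negPf nvs) orbF.
  - by have := h1 s S1s; rewrite eqxx.
rewrite !inE => /andP[nvr /orP[S0v|S1v]].
  by rewrite dominated_cut0 // h0 // !inE nvr.
rewrite dominated_cut1 //; have [->|nvs] := eqVneq v s; first exact: hs.
by rewrite h1 // !inE nvs.
Qed.

(** Reduces membership in the families to booleans; the last two implications exclude the impossible
    rows of the truth tables below. *)
Lemma cutE D : D \subset S0 :|: S1 ->
  [/\ (D \in predominating (S0 :|: S1) r) =
        [&& D :&: S0 \in predominating S0 r, D :&: S1 \in predominating S1 s
          & dominated (D :&: S1) s || (r \in D) && e r s],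
      dominated D r = dominated (D :&: S0) r || (s \in D) && e r s,
      (r \in D :&: S0 = (r \in D)) * (s \in D :&: S1 = (s \in D)),
      r \in D -> dominated (D :&: S0) r
    & s \in D -> dominated (D :&: S1) s].
Proof.
move=> sD; have er : r \in D :&: S0 = (r \in D) by rewrite inE S0r andbT.
have es : s \in D :&: S1 = (s \in D) by rewrite inE S1s andbT.
split; first exact: predominating_cut.
- by rewrite dominated_cut0 // eqxx.
- by [].
- by rewrite -er /dominated => ->.
- by rewrite -es /dominated => ->.
Qed.

(** If [r] is in [D] it dominates [s], so any predominating trace on [S1] will do. Otherwise that
    trace must dominate [s], and [r] is dominated from its own side or by [s]. *)
Lemma fam_edge : e r s ->
  [/\ famA (S0 :|: S1) r =
        glue S0 S1 (famA S0 r) (famA S1 s :|: famB S1 s :|: famC S1 s),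
      famB (S0 :|: S1) r =
        glue S0 S1 (famB S0 r) (famA S1 s :|: famB S1 s)
          :|: glue S0 S1 (famC S0 r) (famA S1 s)
    & famC (S0 :|: S1) r = glue S0 S1 (famC S0 r) (famB S1 s)].
Proof.
move=> ers; split; apply/setP => D; rewrite ?in_setU !in_glue ?in_setU !in_fam;
  have [sD|nsD] := boolP (D \subset S0 :|: S1);
  try by apply/negbTE/negP => /andP[/predominating_subset]; rewrite (negPf nsD).
all: have [-> dE cE hr hs] := cutE sD; move: hr hs; rewrite ?dE ?cE ers !andbT.
all: case: (r \in D); case: (s \in D); case: (dominated (D :&: S0) r);
  case: (dominated (D :&: S1) s) => hr hs;
  try (by case: notF; apply: hr); try (by case: notF; apply: hs).
all: by case: (D :&: S0 \in _); case: (D :&: S1 \in _).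
Qed.

Lemma fam_nonedge : ~~ e r s ->
  let F := famA S1 s :|: famB S1 s in
  [/\ famA (S0 :|: S1) r = glue S0 S1 (famA S0 r) F,
      famB (S0 :|: S1) r = glue S0 S1 (famB S0 r) F
    & famC (S0 :|: S1) r = glue S0 S1 (famC S0 r) F].
Proof.
move=> /negPf ners F; split; apply/setP => D; rewrite in_glue in_setU !in_fam;
  have [sD|nsD] := boolP (D \subset S0 :|: S1);
  try by apply/negbTE/negP => /andP[/predominating_subset]; rewrite (negPf nsD).
all: have [-> dE cE hr hs] := cutE sD; move: hr hs.
all: rewrite ?dE ?cE ners !andbF !orbF.
all: case: (r \in D); case: (s \in D); case: (dominated (D :&: S0) r);
  case: (dominated (D :&: S1) s) => hr hs;
  try (by case: notF; apply: hr); try (by case: notF; apply: hs).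
all: by case: (D :&: S0 \in _); case: (D :&: S1 \in _).
Qed.

Lemma controlled_cut :
  controlled (famA S0 r) (famB S0 r) (famC S0 r) ->
  controlled (famA S1 s) (famB S1 s) (famC S1 s) ->
  controlled (famA (S0 :|: S1) r) (famB (S0 :|: S1) r) (famC (S0 :|: S1) r).
Proof.
move=> g0 g1; have [ers|ners] := boolP (e r s).
  have [-> -> ->] := fam_edge ers.
  by apply: controlled_join => // D; apply: fam_subset.
have [-> -> ->] := fam_nonedge ners.
have [g [bF aF]] := controlled_total g1.
apply: controlled_glue bF aF => // D FD.
  exact: fam_subset FD.
by apply: (@fam_subset _ s); rewrite inE FD.
Qed.

End Cut.

(** * Cutting a forest at an edge, and induction on the vertex set *)

Lemma forest_cut S r s : irreflexive e -> acyclic_graph e ->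
    r \in S -> s \in S -> e r s ->
  exists S0 S1, [/\ S = S0 :|: S1, [disjoint S0 & S1], r \in S0, s \in S1
    & forall x y, x \in S0 -> y \in S1 -> e x y -> x = r /\ y = s].
Proof.
move=> irr acyc Sr Ss ers.
pose f : rel T := fun x y =>
  [&& e x y, y \in S, (x, y) != (r, s) & (x, y) != (s, r)].
(* A duplicate-free path from [s] to [r] closes up with the edge to a cycle; having fewer than 3
   vertices, it would be a loop or use the deleted edge. *)
have nfr : ~~ connect f s r.
  apply/negP => /connectP[p fp lp].
  case/shortenP: fp lp => q fq uq _ lq.
  have ep : path e s q by apply: sub_path fq => x y /and4P[].
  have /acyc : ucycle e (s :: q).
    by apply/andP; split; rewrite //= rcons_path ep -lq.
  case: q fq uq lq {ep} => [|x [|//]] /=.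
    by move=> _ _ ers'; rewrite ers' irr in ers.
  by rewrite andbT => /and4P[_ _ _ /eqP nsr] _ erx; rewrite erx in nsr.
pose S1 := [set x in S | connect f s x].
have S1s : s \in S1 by rewrite inE Ss connect0.
exists (S :\: S1), S1; split=> //.
- apply/setP => x; rewrite !inE; case: (x \in S) => //=.
  by case: (connect f s x).
- by rewrite -setI_eq0 setDE -setIA [_ :&: S1]setIC setICr setI0.
- by rewrite !inE Sr nfr.
move=> x y /setDP[Sx nS1x] S1y exy.
have : ~~ f y x.
  apply: contra nS1x => fyx; rewrite inE Sx /=.
  by move: S1y; rewrite inE => /andP[_ /connect_trans]; apply; apply: connect1.
rewrite /f sym exy Sx /= negb_and !negbK.
case/orP=> /eqP[ey ex]; last by [].
by rewrite ex S1s in nS1x.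
Qed.

(** Strong induction on size: cut at an edge from [r]; if [r] is isolated in [S], split it off and
    root the rest at any other vertex. *)
Lemma forest_controlled S r : irreflexive e -> acyclic_graph e -> r \in S ->
  controlled (famA S r) (famB S r) (famC S r).
Proof.
move=> irr acyc; have [n] := ubnP #|S|; elim: n S r => // n IHn S r le_Sn Sr.
have IH S0 S1 s : S = S0 :|: S1 -> [disjoint S0 & S1] -> r \in S0 ->
    s \in S1 ->
    (forall x y, x \in S0 -> y \in S1 -> e x y -> x = r /\ y = s) ->
    controlled (famA S r) (famB S r) (famC S r).
  move=> eS dis S0r S1s cut; rewrite eS; apply: controlled_cut cut _ _ => //.
    apply: IHn S0r; move: le_Sn; rewrite eS cardsU (disjoint_setI0 dis) cards0.
    by rewrite (cardsD1 s S1) S1s; lia.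
  apply: IHn S1s; move: le_Sn; rewrite eS cardsU (disjoint_setI0 dis) cards0.
  by rewrite (cardsD1 r S0) S0r; lia.
have [/existsP[s /andP[Ss ers]]|noedge] := boolP [exists s in S, e r s].
  by have [S0 [S1 [eS dis S0r S1s cut]]] := forest_cut irr acyc Sr Ss ers;
    apply: IH cut.
have [S0|[s S1s]] := set_0Vmem (S :\ r).
  by rewrite -(setD1K Sr) S0 setU0; apply: controlled_singleton.
apply: (IH [set r] (S :\ r) s) => //.
- by rewrite setD1K.
- by rewrite disjoints1 !inE eqxx.
- by rewrite set11.
move=> x y /set1P-> /setD1P[_ Sy] ery; case/existsP: noedge.
by exists y; rewrite Sy.
Qed.

End Forest.

(** * Minimum dominating sets of the whole forest and the numerical bound *)

Lemma dominatingE (T : finType) (e : rel T) (D : {set T}) :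
  dominating e D = [forall v, dominated e D v].
Proof.
apply/forall_inP/forallP => [h v|h v]; last first.
  by rewrite inE => /negPf nDv; have := h v; rewrite /dominated nDv.
rewrite /dominated; case: (boolP (v \in D)) => //= nDv.
by apply: h; rewrite inE.
Qed.

Lemma forest_count (T : finType) (e : rel T) : forest e ->
  #|[set D : {set T} | min_dominating e D]| * 11 ^ domination_number e
    <= 27 ^ domination_number e.
Proof.
move=> [[sym irr] acyc].
have min_dom D : dominating e D -> domination_number e <= #|D|.
  rewrite /domination_number; case: arg_minnP => [|E _ minE]; last exact: minE.
  by apply/forall_inP => v; rewrite !inE.
have [D0 domD0 cD0] :
    exists2 D, dominating e D & #|D| = domination_number e.
  rewrite /domination_number; case: arg_minnP => [|E domE _]; last by exists E.
  by apply/forall_inP => v; rewrite !inE.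
(* Without vertices there is no root to choose; only the empty set is then counted. *)
have [/eqP T0|] := boolP (#|T| == 0).
  have -> : domination_number e = 0.
    by apply/eqP; rewrite -leqn0 -T0 -cD0 max_card.
  rewrite !expn0 muln1 -(cards1 (set0 : {set T})); apply/subset_leq_card.
  apply/subsetP => D _; rewrite inE -cards_eq0 -leqn0 -T0; exact: max_card.
rewrite -lt0n => /card_gt0P[r _].
have gr : controlled (famA e setT r) (famB e setT r) (famC e setT r).
  by apply: forest_controlled; rewrite ?inE.
have eF : famA e setT r :|: famB e setT r = [set D | dominating e D].
  rewrite famAB ?inE //; apply/setP => D; rewrite !inE subsetT dominatingE.
  by apply/forall_inP/forallP => h v; [apply: h|move=> _; apply: h].
have [g []] := controlled_total gr; rewrite eF => -[leg cg] [D1].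
rewrite inE => domD1 cD1.
have eg : g = domination_number e.
  apply/eqP; rewrite eqn_leq -{2}cD1 min_dom // andbT -cD0 leg // inE //.
move: cg; rewrite -eg -mulnA leq_pmul2l //.
rewrite [X in #|pred_of_set X| * _ <= _ -> _]
  (_ : _ = [set D | min_dominating e D]) //.
by apply/setP => D; rewrite !inE /min_dominating -eg.
Qed.

Import Order.TTheory GRing.Theory Num.Theory.
Local Open Scope ring_scope.

(* The constant 2.4606 is abstracted as [c]: on the literal fraction, conversion
   would unfold large unary numerals. *)
Lemma scaled_bound (c : rat) :
  10000%:R * c = 24606%:R -> 27%:R / 11%:R <= c.
Proof. by lra. Qed.

Theorem theorem1 (T : finType) (e : rel T) (hF : forest e) :
  #|[set D : {set T} | min_dominating e D]|%:R
    <= (24606%:R / 10000%:R) ^+ domination_number e :> rat.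
Proof.
have ge0 : 0 <= 27%:R / 11%:R :> rat by apply: divr_ge0; apply: ler0n.
have count27 : #|[set D | min_dominating e D]|%:R
    <= (27%:R / 11%:R) ^+ domination_number e :> rat.
  have gt0 : 0 < 11%:R ^+ domination_number e :> rat by apply: exprn_gt0.
  (* Clearing the power of 11 turns the claim into the count over the naturals. *)
  rewrite exprMn exprVn (ler_pdivlMr _ _ gt0) -!natrX -natrM ler_nat.
  exact: forest_count.
have divE (a b : rat) : b != 0 -> b * (a / b) = a.
  by move=> nz; rewrite mulrC divfK.
have nz : 10000%:R != 0 :> rat by rewrite pnatr_eq0.
have bound (c : rat) : 10000%:R * c = 24606%:R ->
    #|[set D | min_dominating e D]|%:R <= c ^+ domination_number e.
  move=> /scaled_bound c_ge; apply: le_trans count27 _.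
  exact: lerXn2r ge0 (le_trans ge0 c_ge) c_ge.
apply: bound; exact: divE nz.
Qed.
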